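(* Suppose that $f:\mathbb{R}^n\to\mathbb{R}$ is twice continuously differentiable and $\sigma_f$-weakly convex (i.e. $f(x)+(\sigma_f/2)\|x\|^2$ is convex), that $\nabla f$ is Lipschitz continuous with modulus $\ell_f$, and that $\mu>\sigma_f$. Let $\sigma_g=\mu-\sigma_f$ and let $\ell_g$ be the Lipschitz modulus of $\nabla g$. Let $\{\zeta^j\}_{j\in\mathbb{N}}$ and $\{y^j\}_{j\in\mathbb{N}}$ be respectively the iterate sequence and the multiplier (i.e. negative gradient) sequence generated by the algorithm GSNewton for the problem $\min_{x,u}G(x,u)$. The following hold. (i) The objective value sequence $\{G(\zeta^j)\}_{j\in\mathbb{N}}$ is non-increasing and satisfies $$G(\zeta^j)-G(\zeta^{j+1})\ \ge\ \tau\|\zeta^{j+1/2}-\zeta^j\|^2+\frac{\sigma_g}{4}\|\zeta^{j+1}-\zeta^{j+1/2}\|^2,$$ where $\tau:=\min\{1/(2\alpha)-\ell_g/2,\ 1/t-\ell_g/2\}>0$. Consequently, $$\lim_{j\to\infty}\|\zeta^{j+1/2}-\zeta^j\|=0\quad\text{and}\quad\lim_{j\to\infty}\|\zeta^{j+1}-\zeta^j\|=0.$$ (ii) The sequences $\{\zeta^j\}_{j\in\mathbb{N}}$ and $\{y^j\}_{j\in\mathbb{N}}$ converge respectively to a P-stationary point $\widehat\zeta:=(\widehat x,\widehat u)$ of the problem $\min_{x,u}G(x,u)$ and to the corresponding P-stationary multiplier $\widehat y=-\nabla_u g(\widehat\zeta)$. (iii) It holds that $$\lim_{j\to\infty}\|u^{j+1}_+\|_0=\lim_{j\to\infty}\|u^{j+1/2}_+\|_0=\|\widehat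 u_+\|_0\quad\text{and}\quad\lim_{j\to\infty}G(\zeta^j)=G(\widehat\zeta).$$
   Context: $[m]=\{1,\dots,m\}$; for $T\subseteq[m]$, $\overline T:=[m]\setminus T$ and $v_T$ is the subvector of $v$ indexed by $T$. $\|u_+\|_0$ is the number of strictly positive entries of $u$, and $h(u):=\|u_+\|_0$. Given are $\lambda,\rho,\mu>0$, $A\in\mathbb{R}^{m\times n}$, $b,p\in\mathbb{R}^m$, $q\in\mathbb{R}^n$, and $$g(x,u):=f(x)+\langle p,Ax-u+b\rangle+\tfrac{\rho}{2}\|Ax-u+b\|^2+\tfrac{\mu}{2}\|x-q\|^2,\qquad G(x,u):=g(x,u)+\lambda\|u_+\|_0 .$$ For $\alpha>0$, $\mathrm{Prox}_{\alpha\lambda h(\cdot)}(v):=\arg\min_{z\in\mathbb{R}^m}\{\alpha\lambda h(z)+\tfrac12\|z-v\|^2\}$ (set-valued). $(\widehat x,\widehat u)$ is a P-stationary point of $\min G$ with P-stationary multiplier $\widehat y$ (and constant $\alpha$, here the algorithm's $\alpha$) if $\nabla_x g(\widehat x,\widehat u)=0$, $\widehat y=-\nabla_u g(\widehat x,\widehat u)$ and $\widehat u\in\mathrm{Prox}_{\alpha\lambda h(\cdot)}(\widehat u+\alpha\widehat y)$. Algorithm GSNewton: take $\alpha\in(0,1/\ell_g)$, $t\in(0,2/\ell_g)$ and a starting point $\zeta^0=(x^0,u^0)\in\mathbb{R}^n\times\mathbb{R}^m$. For $j=0,1,\dots$, with $\zeta^j=(x^j,u^j)$ and $y^j:=-\nabla_u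 g(\zeta^j)$: 1. $\Gamma_j:=\{i\in[m]: [u^j+\alpha y^j]_i\in[0,\sqrt{2\alpha\lambda})\}$. 2. $u^{j+1/2}_i:=0$ if $i\in\Gamma_j$ and $u^{j+1/2}_i:=[u^j+\alpha y^j]_i$ if $i\notin\Gamma_j$; $x^{j+1/2}:=x^j-t\nabla_x g(x^j,u^{j+1/2})$; $\zeta^{j+1/2}:=(x^{j+1/2},u^{j+1/2})$. 3. The Newton point $\widetilde\zeta^{j+1}=(\widetilde x^{j+1},\widetilde u^{j+1})$ is the solution $(x,u)$ of $u_{\Gamma_j}=0$ and $$H^{j+1/2}\begin{bmatrix}x-x^{j+1/2}\\(u-u^{j+1/2})_{\overline\Gamma_j}\end{bmatrix}=-\begin{bmatrix}\nabla_x g(\zeta^{j+1/2})\\(\nabla_u g(\zeta^{j+1/2}))_{\overline\Gamma_j}\end{bmatrix},$$ where $H^{j+1/2}$ is the Hessian of $g$ at $\zeta^{j+1/2}$ with respect to the variables $(x,u_{\overline\Gamma_j})$, i.e. it has diagonal blocks $\nabla^2f(x^{j+1/2})+\rho A^\top A+\mu I$ and $\rho I$ and off-diagonal blocks $-\rho(A_{\overline\Gamma_j})^\top$ and $-\rho A_{\overline\Gamma_j}$ ($A_T$ = rows of $A$ indexed by $T$). 4. $\zeta^{j+1}:=\widetilde\zeta^{j+1}$ if $G(\zeta^{j+1/2})-G(\widetilde\zeta^{j+1})\ge(\sigma_g/4)\|\widetilde\zeta^{j+1}-\zeta^{j+1/2}\|^2$ (the Newton step is accepted), and $\zeta^{j+1}:=\zeta^{j+1/2}$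 otherwise. *)

(* Defs.v *)
(* MathComp / MathComp-Analysis. *)
From HB Require Import structures.
From mathcomp Require Import all_boot all_order all_algebra.
From mathcomp Require Import all_classical all_reals all_analysis.

Set Implicit Arguments.
Unset Strict Implicit.
Unset Printing Implicit Defensive.

Import Order.TTheory GRing.Theory Num.Theory.
Import numFieldNormedType.Exports.

Local Open Scope classical_set_scope.
Local Open Scope ring_scope.

Section Euclidean.
Context {R : realType} {k : nat}.
Implicit Types (v w x : 'cV[R]_k) (F : 'cV[R]_k -> R).

Definition dotv v w : R := \sum_i v i 0 * w i 0.

(* The library norm `|v| of a matrix is the sup norm. It induces the same
   topology, so limits and differentiability below use the library structures,
   but quantitative statements use this Euclidean norm. *)
Definition enorm v : R := Num.sqrt (\sum_i v i 0 ^+ 2).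

Definition grad F x : 'cV[R]_k := \col_i 'D_(delta_mx i 0) F x.

Definition hess F x : 'M[R]_k :=
  \matrix_(i, j) 'D_(delta_mx j 0) (fun z => grad F z i 0) x.

Definition twice_continuously_differentiable F : Prop :=
  [/\ forall x, differentiable F x,
      forall x, differentiable (grad F) x
    & continuous (hess F)].

Definition weakly_convex (sigma : R) F : Prop :=
  convex_function [set: convex_lmodType 'cV[R]_k]
    (fun x => F x + sigma / 2 * enorm x ^+ 2).

Definition lipschitz_gradient (l : R) F : Prop :=
  forall x x', enorm (grad F x - grad F x') <= l * enorm (x - x').

(* ||v_+||_0 *)
Definition npos v : nat := #|[pred i | 0 < v i 0]|.

(* Prox_{c h} with h = npos *)
Definition prox_npos (c : R) v : set 'cV[R]_k :=
  [set z | forall z', c * (npos z)%:R + 2^-1 * enorm (z - v) ^+ 2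
                   <= c * (npos z')%:R + 2^-1 * enorm (z' - v) ^+ 2].

End Euclidean.

(* The rows of M indexed by T, in increasing order; for a column vector, the
   subvector v_T. *)
Definition subrows {R : realType} {m n : nat} (T : {set 'I_m})
    (M : 'M[R]_(m, n)) : 'M[R]_(#|T|, n) :=
  rowsub (fun k : 'I_#|T| => enum_val k) M.

Section Problem.
Context {R : realType} {m n : nat}.
Variables (f : 'cV[R]_n -> R) (lambda rho mu : R).
Variables (A : 'M[R]_(m, n)) (b p : 'cV[R]_m) (q : 'cV[R]_n).

(* A point (x, u) of R^n x R^m is the column z = col_mx x u, with x = usubmx z
   and u = dsubmx z. *)
Implicit Types z : 'cV[R]_(n + m).

Definition gfun z : R :=
  let x := usubmx z in
  let u := dsubmx z in
  f x + dotv p (A *m x - u + b) + rho / 2 * enorm (A *m x - u + b) ^+ 2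
    + mu / 2 * enorm (x - q) ^+ 2.

Definition Gfun z : R := gfun z + lambda * (npos (dsubmx z))%:R.

Definition grad_x z : 'cV[R]_n := usubmx (grad gfun z).

Definition grad_u z : 'cV[R]_m := dsubmx (grad gfun z).

Definition P_stationary (alpha : R) z (y : 'cV[R]_m) : Prop :=
  [/\ grad_x z = 0, y = - grad_u z
    & prox_npos (alpha * lambda) (dsubmx z + alpha *: y) (dsubmx z)].

Definition forward_u (alpha : R) z : 'cV[R]_m :=
  dsubmx z + alpha *: - grad_u z.

Definition Gamma (alpha : R) z : {set 'I_m} :=
  [set i | 0 <= forward_u alpha z i 0 < Num.sqrt (2 * alpha * lambda)].

Definition half_step (alpha t : R) z : 'cV[R]_(n + m) :=
  let u' := \col_i (if i \in Gamma alpha z then 0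
                    else forward_u alpha z i 0) in
  let x' := usubmx z - t *: grad_x (col_mx (usubmx z) u') in
  col_mx x' u'.

(* Hessian of g at z with respect to (x, u_(~: T)) *)
Definition partial_hess (T : {set 'I_m}) z : 'M[R]_(n + #|~: T|) :=
  block_mx
    (hess f (usubmx z) + rho *: (A^T *m A) + mu%:M)
    (- rho *: (subrows (~: T) A)^T)
    (- rho *: subrows (~: T) A)
    rho%:M.

Definition is_newton_point (T : {set 'I_m}) z z' : Prop :=
  subrows T (dsubmx z') = 0 /\
  partial_hess T z *m col_mx (usubmx z' - usubmx z)
                             (subrows (~: T) (dsubmx z' - dsubmx z))
    = - col_mx (grad_x z) (subrows (~: T) (grad_u z)).

(* zeta, zeta_half and zeta_newton are the sequences of iterates, of points
   zeta^{j+1/2}, and of Newton points (the one computed at step j has index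
   j). *)
Definition GSNewton (sigma_g alpha t : R)
    (zeta zeta_half zeta_newton : nat -> 'cV[R]_(n + m)) : Prop :=
  forall j,
    [/\ zeta_half j = half_step alpha t (zeta j),
        is_newton_point (Gamma alpha (zeta j)) (zeta_half j) (zeta_newton j)
      & zeta j.+1 =
          if sigma_g / 4 * enorm (zeta_newton j - zeta_half j) ^+ 2
               <= Gfun (zeta_half j) - Gfun (zeta_newton j)
          then zeta_newton j else zeta_half j].

End Problem.

(* Main.v *)
(* Each half step is a proximal step in u followed by a gradient step in x, so
   the descent lemma makes G decrease by at least a multiple of the squared
   displacement; an accepted Newton step only decreases G further. As g is
   strongly monotone, hence bounded below, all displacements tend to 0. The
   gradient of g at the half step, restricted to the coordinates left free by
   Gamma_j, is O(|zeta^{j+1/2} - zeta^j|); by strong monotonicity two half steps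
   with the same index set are therefore close. There are finitely many index
   sets, so the half steps approach a finite set of points with vanishing steps,
   and hence converge. *)
Require Import Defs.
From HB Require Import structures.
From mathcomp Require Import all_boot all_order all_algebra.
From mathcomp Require Import all_classical all_reals all_analysis.
From mathcomp Require Import ring lra.

Import Order.TTheory GRing.Theory Num.Theory.
Import numFieldNormedType.Exports.

Local Open Scope classical_set_scope.
Local Open Scope ring_scope.

(** * Euclidean inner product and norm *)

Section EuclideanTheory.
Context {R : realType} {k : nat}.
Implicit Types (u v w : 'cV[R]_k) (a : R).

Lemma dotvC v w : dotv v w = dotv w v.
Proof. by apply: eq_bigr => i _; rewrite mulrC. Qed.

Lemma dotvDl u v w : dotv (u + v) w = dotv u w + dotv v w.
Proof. by rewrite -big_split; apply: eq_bigr => i _; rewrite !mxE mulrDl. Qed.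

Lemma dotvZl a v w : dotv (a *: v) w = a * dotv v w.
Proof. by rewrite mulr_sumr; apply: eq_bigr => i _; rewrite !mxE mulrA. Qed.

Lemma dotvDr u v w : dotv u (v + w) = dotv u v + dotv u w.
Proof. by rewrite dotvC dotvDl !(dotvC u). Qed.

Lemma dotvZr a v w : dotv v (a *: w) = a * dotv v w.
Proof. by rewrite dotvC dotvZl dotvC. Qed.

Lemma dotvNl v w : dotv (- v) w = - dotv v w.
Proof. by rewrite -scaleN1r dotvZl mulN1r. Qed.

Lemma dotvNr v w : dotv v (- w) = - dotv v w.
Proof. by rewrite dotvC dotvNl dotvC. Qed.

Lemma dotvBl u v w : dotv (u - v) w = dotv u w - dotv v w.
Proof. by rewrite dotvDl dotvNl. Qed.

Lemma dotvBr u v w : dotv u (v - w) = dotv u v - dotv u w.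
Proof. by rewrite dotvDr dotvNr. Qed.

Lemma dotv0r v : dotv v 0 = 0.
Proof. by rewrite -(scale0r v) dotvZr mul0r. Qed.

Lemma dotv_delta v i : dotv v (delta_mx i 0) = v i 0.
Proof.
rewrite /dotv (bigD1 i)//= mxE !eqxx mulr1 big1 ?addr0// => j ji.
by rewrite mxE (negPf ji) mulr0.
Qed.

Lemma enorm_ge0 v : 0 <= enorm v.
Proof. exact: sqrtr_ge0. Qed.

Lemma sqr_enorm v : enorm v ^+ 2 = dotv v v.
Proof.
rewrite sqr_sqrtr; last by apply: sumr_ge0 => i _; rewrite sqr_ge0.
by apply: eq_bigr => i _; rewrite expr2.
Qed.

Lemma dotvv_ge0 v : 0 <= dotv v v.
Proof. by rewrite -sqr_enorm sqr_ge0. Qed.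

Lemma enormZ a v : enorm (a *: v) = `|a| * enorm v.
Proof.
rewrite /enorm -sqrtr_sqr -sqrtrM ?sqr_ge0// mulr_sumr; congr Num.sqrt.
by apply: eq_bigr => i _; rewrite mxE exprMn.
Qed.

Lemma enormN v : enorm (- v) = enorm v.
Proof. by congr Num.sqrt; apply: eq_bigr => i _; rewrite mxE sqrrN. Qed.

Lemma enorm_dist v w : enorm (v - w) = enorm (w - v).
Proof. by rewrite -enormN opprB. Qed.

Lemma enorm0 : enorm (0 : 'cV[R]_k) = 0.
Proof.
by rewrite /enorm big1 ?sqrtr0// => i _; rewrite mxE expr0n.
Qed.

Lemma normr_le_enorm v i : `|v i 0| <= enorm v.
Proof.
rewrite -ler_sqr ?nnegrE ?enorm_ge0// sqr_enorm /dotv (bigD1 i)//=.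
rewrite -normrX ger0_norm ?sqr_ge0// expr2 lerDl sumr_ge0// => j _.
by rewrite -expr2 sqr_ge0.
Qed.

Lemma enorm_eq0 v : enorm v = 0 -> v = 0.
Proof.
move=> v0; apply/matrixP => i j; rewrite ord1 mxE; apply/eqP.
by rewrite -normr_eq0 -normr_le0 normr_id -v0 normr_le_enorm.
Qed.

(** Cauchy-Schwarz: with both norms positive, expand the squared norm of
    [enorm w *: v - enorm v *: w], which is nonnegative, and cancel the factor
    [enorm v * enorm w]. *)
Lemma dotv_le v w : dotv v w <= enorm v * enorm w.
Proof.
have := enorm_ge0 v; rewrite le0r => /orP[/eqP/enorm_eq0->|v0].
  by rewrite enorm0 mul0r -(scale0r v) dotvZl mul0r.
have := enorm_ge0 w; rewrite le0r => /orP[/eqP/enorm_eq0->|w0].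
  by rewrite enorm0 mulr0 -(scale0r w) dotvZr mul0r.
have := dotvv_ge0 (enorm w *: v - enorm v *: w).
rewrite dotvBl !dotvBr !dotvZl !dotvZr -!sqr_enorm (dotvC w v).
set a := enorm v in v0 *; set b := enorm w in w0 *; set d := dotv v w => h.
have ab : 0 < a * b by rewrite mulr_gt0.
rewrite -(ler_pM2l ab); lra.
Qed.

Lemma ler_enormD v w : enorm (v + w) <= enorm v + enorm w.
Proof.
rewrite -ler_sqr ?nnegrE ?addr_ge0 ?enorm_ge0//.
rewrite sqr_enorm dotvDl !dotvDr (dotvC w v) sqrrD !sqr_enorm.
have := dotv_le v w; lra.
Qed.

Lemma ler_enorm_dist u v w : enorm (u - w) <= enorm (u - v) + enorm (v - w).
Proof. by rewrite -(subrKA v u) ler_enormD. Qed.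

Lemma ler_normr_enorm v : `|v| <= enorm v.
Proof.
rewrite [leLHS]/Num.norm /= mx_normrE; apply/bigmax_leP; split=> [|[i j] _ /=].
  exact: enorm_ge0.
by rewrite ord1 normr_le_enorm.
Qed.

Lemma ler_enorm_normr v : enorm v <= Num.sqrt k%:R * `|v|.
Proof.
rewrite -ler_sqr ?nnegrE ?enorm_ge0 ?mulr_ge0 ?sqrtr_ge0//.
rewrite sqr_enorm exprMn sqr_sqrtr ?ler0n//.
rewrite -[k in k%:R]card_ord mulr_natl -sumr_const; apply: ler_sum => i _.
rewrite -expr2 -real_normK ?num_real// ler_sqr ?nnegrE//.
rewrite [leRHS]/Num.norm /= mx_normrE; apply/bigmax_geP; right => /=.
by exists (i, 0).
Qed.

Lemma npos_sum v : (npos v)%:R = \sum_i (0 < v i 0)%R%:R :> R.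
Proof.
rewrite /npos -sum1_card natr_sum big_mkcond/=; apply: eq_bigr => i _.
by rewrite inE; case: ifP.
Qed.

End EuclideanTheory.

(** * Block vectors and matrix bounds *)

Lemma dotv_col_mx {R : realType} {n m : nat} (z d : 'cV[R]_(n + m)) :
  dotv z d = dotv (usubmx z) (usubmx d) + dotv (dsubmx z) (dsubmx d).
Proof.
rewrite /dotv big_split_ord/=.
by congr (_ + _); apply: eq_bigr => i _; rewrite !mxE.
Qed.

Lemma enorm_usubmx {R : realType} {n m : nat} (z : 'cV[R]_(n + m)) :
  enorm (usubmx z) <= enorm z.
Proof.
rewrite -ler_sqr ?nnegrE ?enorm_ge0// !sqr_enorm dotv_col_mx lerDl.
exact: dotvv_ge0.
Qed.

Lemma enorm_dsubmx {R : realType} {n m : nat} (z : 'cV[R]_(n + m)) :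
  enorm (dsubmx z) <= enorm z.
Proof.
rewrite -ler_sqr ?nnegrE ?enorm_ge0// !sqr_enorm dotv_col_mx lerDr.
exact: dotvv_ge0.
Qed.

Lemma dotv_adj {R : realType} {m n : nat} (A : 'M[R]_(m, n)) v w :
  dotv (A *m v) w = dotv v (A^T *m w).
Proof.
have E k (x y : 'cV[R]_k) : dotv x y = (x^T *m y) 0 0.
  by rewrite mxE; apply: eq_bigr => i _; rewrite mxE.
by rewrite !E trmx_mul mulmxA.
Qed.

(** The constant is the squared Frobenius norm of [A]; Cauchy-Schwarz is applied row by row. *)
Lemma mulmx_enorm_bound {R : realType} {m n : nat} (A : 'M[R]_(m, n)) :
  exists2 a, 0 <= a & forall v, enorm (A *m v) ^+ 2 <= a * enorm v ^+ 2.
Proof.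
exists (\sum_i enorm (row i A)^T ^+ 2).
  by apply: sumr_ge0 => i _; rewrite sqr_ge0.
move=> v; rewrite [leLHS]sqr_enorm mulr_suml; apply: ler_sum => i _.
have -> : (A *m v) i 0 = dotv (row i A)^T v.
  by rewrite mxE; apply: eq_bigr => j _; rewrite !mxE.
set r := (row i A)^T; rewrite -exprMn -expr2.
rewrite -real_normK ?num_real// ler_sqr ?nnegrE ?mulr_ge0 ?enorm_ge0//.
rewrite ler_norml dotv_le andbT lerNl -dotvNl -(enormN r); exact: dotv_le.
Qed.

(** * Directional derivatives *)

Lemma is_derive_grad {R : realType} {k : nat} (F : 'cV[R]_k -> R) x d :
  differentiable F x -> is_derive x d F (dotv (grad F x) d).
Proof.
move=> dF; apply: DeriveDef; first exact: diff_derivable.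
rewrite deriveE// {1}(matrix_sum_delta d) linear_sum; apply: eq_bigr => i _.
by rewrite big_ord1 linearZ /= mxE deriveE// mulrC.
Qed.

(** The two difference quotients are the same function of [h], so derivability of [F] in the single
    direction [L d] is enough. *)
Lemma is_derive_comp_lin {R : realType} {U V W : normedModType R}
    (L : {linear U -> V}) (F : V -> W) z d l :
  is_derive (L z) (L d) F l -> is_derive z d (F \o L) l.
Proof.
have E : (fun h : R => h^-1 *: ((F \o shift (L z)) (h *: L d) - F (L z))) =
    (fun h => h^-1 *: (((F \o L) \o shift z) (h *: d) - (F \o L) z)).
  by apply/funext => h /=; rewrite linearP.
by case=> dF vF; apply: DeriveDef; rewrite /derivable /derive -E.
Qed.

(** For [h != 0] the difference quotient is exactly [a + h * c], so expanding a quadratic yields its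
    derivative without a chain rule. *)
Lemma is_derive_quadratic {R : realType} {V : normedModType R} (Q : V -> R)
    z d a c :
  (forall h, Q (h *: d + z) = Q z + h * a + h ^+ 2 * c) -> is_derive z d Q a.
Proof.
move=> QE.
have cv : h^-1 *: ((Q \o shift z) (h *: d) - Q z) @[h --> 0^'] --> a.
  have : (a + h * c) @[h --> (0:R)^'] --> a.
    rewrite -[X in _ --> X]addr0 -[X in _ --> _ + X](mul0r c).
    apply: cvgD; first exact: cvg_cst.
    by apply: cvgMr_tmp; apply: cvg_within_filter; exact: cvg_id.
  apply: cvg_trans; apply: near_eq_cvg; near=> h.
  rewrite /= QE; have h0 : h != 0 by near: h; exact: nbhs_dnbhs_neq.
  by rewrite /GRing.scale/=; field.
by apply: DeriveDef; [apply/cvg_ex; exists a|exact: cvg_lim].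
Unshelve. all: by end_near. Qed.

Lemma is_derive_line {R : realType} {V W : normedModType R} (F : V -> W)
    z d (s : R) l :
  is_derive (s *: d + z) d F l -> is_derive s 1 (fun s => F (s *: d + z)) l.
Proof.
have E : (fun h : R => h^-1 *: ((F \o shift (s *: d + z)) (h *: d)
      - F (s *: d + z))) =
    (fun h => h^-1 *: (((fun s => F (s *: d + z)) \o shift s) (h *: 1)
      - F (s *: d + z))).
  by apply/funext => h /=; rewrite [h *: 1]mulr1 scalerDl addrA.
by case=> dF vF; apply: DeriveDef; rewrite /derivable /derive -E.
Qed.

(** Subtract from [F] the quadratic with slope [F' 0] at 0 and second derivative [K]. The difference
    [D] has nonpositive derivative for [s > 0], and the mean value theorem on [0, 1] concludes. *)
Lemma second_order_le {R : realType} (F F' : R -> R) (K : R) :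
  (forall s : R, is_derive s 1 F (F' s)) ->
  (forall s, 0 < s -> F' s <= F' 0 + s * K) ->
  F 1 <= F 0 + F' 0 + K / 2.
Proof.
move=> dF F'le.
pose D s := F s - (s * F' 0 + s ^+ 2 * (K / 2)).
have dD (s : R) : is_derive s 1 D (F' s - (F' 0 + s * K)).
  apply: is_deriveB.
  apply: (@is_derive_quadratic _ _ _ _ _ _ (K / 2)) => h.
  by rewrite /GRing.scale/= mulr1; field.
have [|s] := @MVT R D _ 0 1 ltr01 (fun s _ => dD s).
  by apply: derivable_within_continuous => s _; exact: ex_derive.
rewrite in_itv/= => /andP[s0 _]; have := F'le _ s0; rewrite /D; lra.
Qed.

(** * Gradient of the smooth part [g] *)

Lemma usubmxB {R : zmodType} {m1 m2 n : nat} (z z' : 'M[R]_(m1 + m2, n)) :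
  usubmx (z - z') = usubmx z - usubmx z'.
Proof. by apply/matrixP => i j; rewrite !mxE. Qed.

Lemma dsubmxB {R : zmodType} {m1 m2 n : nat} (z z' : 'M[R]_(m1 + m2, n)) :
  dsubmx (z - z') = dsubmx z - dsubmx z'.
Proof. by apply/matrixP => i j; rewrite !mxE. Qed.

Section GradientOfG.
Context {R : realType} {m n : nat}.
Variables (f : 'cV[R]_n -> R) (rho mu : R).
Variables (A : 'M[R]_(m, n)) (b p : 'cV[R]_m) (q : 'cV[R]_n).
Hypothesis df : forall x, differentiable f x.
Implicit Types z d : 'cV[R]_(n + m).

Local Notation g := (gfun f rho mu A b p q).
Local Notation res z := (A *m usubmx z - dsubmx z + b).

(** [g] is [f] composed with a linear projection plus a quadratic [Q], and each piece has its own
    differentiation rule. *)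
Let is_derive_gfun_dotv z d : is_derive z d g
  (dotv (grad f (usubmx z)) (usubmx d)
   + (dotv (p + rho *: res z) (A *m usubmx d - dsubmx d)
      + mu * dotv (usubmx z - q) (usubmx d))).
Proof.
pose Q z := dotv p (res z) + rho / 2 * enorm (res z) ^+ 2
            + mu / 2 * enorm (usubmx z - q) ^+ 2.
have -> : g = f \o usubmx + Q :> (_ -> R).
  by apply/funext => y; rewrite /g /Q fctE /= !addrA.
apply: is_deriveD; first by apply: is_derive_comp_lin; exact: is_derive_grad.
set w := res z; set x := usubmx z; set dx := usubmx d; set du := dsubmx d.
apply: (@is_derive_quadratic _ _ _ _ _ _
  (rho / 2 * enorm (A *m dx - du) ^+ 2 + mu / 2 * enorm dx ^+ 2)) => h.
have E1 : res (h *: d + z) = h *: (A *m dx - du) + w.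
  rewrite !linearP /= scalerBr scalerN !addrA; congr (_ - _ + _).
  by rewrite addrAC.
have E2 : usubmx (h *: d + z) - q = h *: dx + (x - q).
  by rewrite linearP /= addrA.
rewrite /Q E1 E2 -/w -/x !sqr_enorm.
move: (A *m dx - du) (x - q) (w : 'cV[R]_m) => dw xq r.
rewrite !(dotvDl, dotvDr, dotvZl, dotvZr) (dotvC dw r) (dotvC dx xq).
by field.
Qed.

(** [grad] is defined coordinatewise, so the directional derivative is first written as the inner
    product with an explicit vector [e]; testing on basis vectors identifies [e] with [grad g z]. *)
Lemma dotv_grad_gfun z d : dotv (grad g z) d =
  dotv (grad f (usubmx z)) (usubmx d)
  + (dotv (p + rho *: res z) (A *m usubmx d - dsubmx d)
     + mu * dotv (usubmx z - q) (usubmx d)).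
Proof.
pose e := col_mx (grad f (usubmx z) + A^T *m (p + rho *: res z)
                  + mu *: (usubmx z - q))
                 (- (p + rho *: res z)).
have eE d' : dotv (grad f (usubmx z)) (usubmx d')
  + (dotv (p + rho *: res z) (A *m usubmx d' - dsubmx d')
     + mu * dotv (usubmx z - q) (usubmx d')) = dotv e d'.
  rewrite dotv_col_mx col_mxKu col_mxKd !(dotvDl (_ + _)) (dotvDl (grad f _)).
  by rewrite dotv_adj trmxK dotvNl dotvBr dotvZl; ring.
rewrite eE; congr dotv; apply/matrixP => i j; rewrite ord1 mxE.
by have [_ ->] := is_derive_gfun_dotv z (delta_mx i 0); rewrite eE dotv_delta.
Qed.

Lemma is_derive_gfun z d : is_derive z d g (dotv (grad g z) d).
Proof. by rewrite dotv_grad_gfun; exact: is_derive_gfun_dotv. Qed.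

Lemma dotv_grad_gfunB z z' d :
  dotv (grad g z - grad g z') d
  = dotv (grad f (usubmx z) - grad f (usubmx z')) (usubmx d)
    + rho * dotv (A *m usubmx (z - z') - dsubmx (z - z'))
                 (A *m usubmx d - dsubmx d)
    + mu * dotv (usubmx (z - z')) (usubmx d).
Proof.
have -> : A *m usubmx (z - z') - dsubmx (z - z') = res z - res z'.
  rewrite usubmxB dsubmxB mulmxBr.
  move: (A *m usubmx z) (A *m usubmx z') => x x'.
  by apply/matrixP => i j; rewrite !mxE; ring.
have -> : usubmx (z - z') = usubmx z - q - (usubmx z' - q).
  by rewrite usubmxB opprB addrA subrK.
rewrite !(dotvBl (grad _ _)) !dotv_grad_gfun.
move: (A *m usubmx d - dsubmx d) (usubmx d) (res z) (res z') => e dx r r'.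
move: (usubmx z - q) (usubmx z' - q) => xq xq'.
rewrite !(dotvBl xq) !(dotvBl r) !(dotvDl p) !dotvZl; ring.
Qed.

End GradientOfG.

(** * Convexity, descent and strong monotonicity *)

(** By convexity the difference quotient is at most [F y - F x] for every step [h] in (0, 1]; let
    [h] decrease to 0. *)
Lemma convex_derive_le {R : realType} {V : normedModType R} (F : V -> R)
    x y l :
  convex_function [set: convex_lmodType V] F -> is_derive x (y - x) F l ->
  l <= F y - F x.
Proof.
move=> cF [dF <-]; apply: (@cvgr_to_le _ (0 : R)^'+).
  exact: cvg_dnbhs_at_right dF.
near=> h; rewrite /= [_ *: _]mulrC.
have h0 : 0 < h by near: h; exact: nbhs_right_gt.
have h1 : h <= 1 by near: h; exact: nbhs_right_le.
rewrite ler_pdivrMr//.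
have := cF (Itv01 (ltW h0) h1) y x (in_setT _) (in_setT _).
have -> : conv (Itv01 (ltW h0) h1) (y : convex_lmodType V) x
    = h *: (y - x) + x.
  transitivity (h *: y + (1 - h) *: x) => //.
  by rewrite scalerBl scale1r scalerBr addrAC addrA.
rewrite [leRHS](_ : _ = h * F y + (1 - h) * F x)//; lra.
Unshelve. all: by end_near. Qed.

(** Add the first-order convexity inequalities of [F + sigma / 2 * enorm ^+ 2] at [x] and at [y];
    the quadratic contributes [sigma * enorm (x - y) ^+ 2]. *)
Lemma weakly_convex_grad {R : realType} {k : nat} (sigma : R)
    (F : 'cV[R]_k -> R) x y :
  weakly_convex sigma F -> (forall x, differentiable F x) ->
  - sigma * enorm (x - y) ^+ 2 <= dotv (grad F x - grad F y) (x - y).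
Proof.
move=> wF dF.
have dS u v : is_derive u v (fun z => F z + sigma / 2 * enorm z ^+ 2)
    (dotv (grad F u) v + sigma * dotv u v).
  apply: is_deriveD; first exact: is_derive_grad.
  apply: (@is_derive_quadratic _ _ _ _ _ _ (sigma / 2 * dotv v v)) => h.
  rewrite !sqr_enorm !(dotvDl, dotvDr, dotvZl, dotvZr) (dotvC v u).
  by field.
have := convex_derive_le _ _ _ _ wF (dS x (y - x)).
have := convex_derive_le _ _ _ _ wF (dS y (x - y)).
rewrite -(opprB x y) !dotvNr !sqr_enorm (dotvBl (grad F x)).
set d := x - y; have -> : dotv d d = dotv x d - dotv y d by rewrite -dotvBl.
lra.
Qed.

(** Strong convexity enters the argument in this first-order form. *)
Definition strongly_monotone_grad {R : realType} {k : nat} (c : R)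
    (F : 'cV[R]_k -> R) : Prop :=
  forall z z',
    c * enorm (z - z') ^+ 2 <= dotv (grad F z - grad F z') (z - z').

Section SmoothStronglyMonotone.
Context {R : realType} {k : nat}.
Variable F : 'cV[R]_k -> R.
Hypothesis dF : forall z d, is_derive z d F (dotv (grad F z) d).

(** Along the segment from [z] to [z + d] the Lipschitz bound makes the slope grow at rate at most
    [l * enorm d ^+ 2]; apply [second_order_le]. *)
Lemma descent_lemma (l : R) z d : lipschitz_gradient l F ->
  F (z + d) <= F z + dotv (grad F z) d + l / 2 * enorm d ^+ 2.
Proof.
move=> lF.
have := @second_order_le _ (fun s => F (s *: d + z)) _ (l * enorm d ^+ 2)
  (fun s => is_derive_line _ _ _ _ _ (dF (s *: d + z) d)).
rewrite scale0r scale1r add0r (addrC d) mulrAC; apply=> s s0.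
rewrite -lerBlDl -dotvBl (le_trans (dotv_le _ _))// expr2 !mulrA.
rewrite ler_wpM2r ?enorm_ge0// (le_trans (lF _ _))// addrK.
by rewrite enormZ gtr0_norm//; lra.
Qed.

(** Mirror image of the descent lemma: [second_order_le] applied to [- F], with strong monotonicity
    bounding the slope from the other side. *)
Lemma strong_monotone_lower (c : R) z d :
  strongly_monotone_grad c F ->
  F z + dotv (grad F z) d + c / 2 * enorm d ^+ 2 <= F (z + d).
Proof.
move=> cF.
have := @second_order_le _ (fun s => - F (s *: d + z))
  (fun s => - dotv (grad F (s *: d + z)) d) (- (c * enorm d ^+ 2)).
rewrite scale0r scale1r add0r (addrC d) => H.
suff : - F (z + d) <= - F z - dotv (grad F z) d - c * enorm d ^+ 2 / 2 by lra.
rewrite -mulNr; apply: H => [s|s s0]; first exact/is_deriveN/is_derive_line.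
have := cF (s *: d + z) z; rewrite addrK !sqr_enorm dotvZl !dotvZr dotvBl => h.
rewrite -(ler_pM2l s0); lra.
Qed.

(** The bound is the minimum over [e = enorm z] of [F 0 - a * e + c / 2 * e ^+ 2], found by
    completing the square. *)
Lemma strong_monotone_bounded_below (c : R) : 0 < c ->
  strongly_monotone_grad c F ->
  exists M, forall z, M <= F z.
Proof.
move=> c0 cF; exists (F 0 - enorm (grad F 0) ^+ 2 / (2 * c)) => z.
have := @strong_monotone_lower c 0 z cF; rewrite add0r; apply: le_trans.
have := dotv_le (- grad F 0) z; rewrite dotvNl enormN.
set a := enorm (grad F 0); set e := enorm z => h.
have : 0 <= (c * e - a) ^+ 2 / (2 * c).
  by rewrite divr_ge0 ?sqr_ge0 ?mulr_ge0 ?ltW.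
have -> : (c * e - a) ^+ 2 / (2 * c)
    = c / 2 * e ^+ 2 - a * e + a ^+ 2 / (2 * c).
  by field; exact: lt0r_neq0.
lra.
Qed.

(** The sum of the two hypotheses bounds the monotonicity product by [(a + a') * enorm (w - w')],
    while strong monotonicity bounds it below by [c * enorm (w - w') ^+ 2]; divide by the
    distance. *)
Lemma strong_monotone_dist (c a a' : R) w w' : 0 < c ->
  strongly_monotone_grad c F ->
  0 <= a -> 0 <= a' ->
  dotv (grad F w) (w - w') <= a * enorm (w - w') ->
  dotv (grad F w') (w' - w) <= a' * enorm (w' - w) ->
  enorm (w - w') <= (a + a') / c.
Proof.
move=> c0 cF a0 a'0; rewrite (enorm_dist w') -(opprB w w') dotvNr => h h'.
have := enorm_ge0 (w - w'); rewrite le0r => /orP[/eqP->|d0].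
  by rewrite divr_ge0 ?addr_ge0 ?(ltW c0).
rewrite ler_pdivlMr// -(ler_pM2r d0).
have := cF w w'; rewrite dotvBl => /le_trans/(_ (lerD h h')); lra.
Qed.

End SmoothStronglyMonotone.

(** The gradient difference yields [(mu - sigma) * |dx|^2 + rho * |A dx - du|^2], with [dx], [du]
    the blocks of [z - z']. The second term controls [du] only relative to [A dx], which the first
    term controls in turn. *)
Lemma gfun_strong_monotone {R : realType} {m n : nat} (f : 'cV[R]_n -> R)
    (sigma rho mu : R) (A : 'M[R]_(m, n)) b p q :
  0 < rho -> (forall x, differentiable f x) -> weakly_convex sigma f ->
  sigma < mu ->
  exists2 c, 0 < c & strongly_monotone_grad c (gfun f rho mu A b p q).
Proof.
move=> rho0 df wf smu; have [a a0 aA] := mulmx_enorm_bound A.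
have a1 : 0 < 1 + 2 * a by lra.
have s0 : 0 < mu - sigma by lra.
(* Since |du|^2 <= 2 |A dx - du|^2 + 2 a |dx|^2, the target [c * (|dx|^2 + |du|^2)] needs exactly
   [c * (1 + 2 * a) <= mu - sigma] and [2 * c <= rho]. *)
pose c := Num.min ((mu - sigma) / (1 + 2 * a)) (rho / 2).
have c0 : 0 < c by rewrite lt_min !divr_gt0.
have ca : c * (1 + 2 * a) <= mu - sigma by rewrite -ler_pdivlMr// ge_min lexx.
have cr : c <= rho / 2 by rewrite ge_min lexx orbT.
exists c => // z z'; rewrite dotv_grad_gfunB//.
have := weakly_convex_grad sigma _ (usubmx z) (usubmx z') wf df.
rewrite -usubmxB; have := aA (usubmx (z - z')).
rewrite !sqr_enorm (dotv_col_mx (z - z')).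
set dx := usubmx (z - z'); set du := dsubmx (z - z').
move: (A *m dx) (dotv (grad f _ - _) dx) => y G YX GX.
(* |du|^2 <= 2 |y - du|^2 + 2 |y|^2 *)
have h1 := dotvv_ge0 (y + y - du); have h2 := dotvv_ge0 (y - du).
have := dotvv_ge0 dx.
move: h1 h2 YX GX; rewrite !(dotvDl, dotvDr, dotvNl, dotvNr) (dotvC du y).
move: (dotv dx dx) (dotv y y) (dotv du du) (dotv y du).
move=> X Y U W h1 h2 YX GX X0.
have := mulr_ge0 (ltW c0) h1; have := ler_wpM2l (ltW c0) YX.
have := ler_wpM2r X0 ca; have := ler_wpM2r h2 cr; lra.
Qed.

(** * Convergence of vector sequences *)

Lemma enorm_cvg {R : realType} {k : nat} (w : nat -> 'cV[R]_k) l :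
  enorm (w j - l) @[j --> \oo] --> (0 : R) <-> w @ \oo --> l.
Proof.
split=> wl.
  apply/subr_cvg0/norm_cvg0P; apply: (squeeze_cvgr _ (cvg_cst 0) wl).
  by apply: nearW => j; rewrite normr_ge0 ler_normr_enorm.
apply: (@squeeze_cvgr _ _ _ _ (fun=> 0) (fun j => Num.sqrt k%:R * `|w j - l|)).
- by apply: nearW => j; rewrite enorm_ge0 ler_enorm_normr.
- exact: cvg_cst.
- rewrite -(mulr0 (Num.sqrt k%:R)); apply: cvgMl_tmp.
  by apply/norm_cvg0P/subr_cvg0.
Qed.

Lemma label_cvg {R : realType} {k : nat} {T : eqType} (lab : nat -> T)
    (w : nat -> 'cV[R]_k) (e : nat -> R) t :
  e @ \oo --> (0 : R) ->
  (forall i j, lab i = lab j -> enorm (w i - w j) <= e i + e j) ->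
  exists l, forall eps, 0 < eps ->
    \forall j \near \oo, lab j = t -> enorm (w j - l) < eps.
Proof.
move=> e0 we.
have [[N labN]|inf_t] := pselect (exists N, forall j, (N <= j)%N -> lab j <> t).
  (* Here [t] is eventually absent, so any point serves as limit. *)
  by exists 0 => eps _; exists N => // j /= /labN.
(* The filter of large indices with label [t] replaces the extraction of a subsequence; it is proper
   because [t] recurs forever. *)
pose F := within [set j | lab j = t] \oo.
have PF : ProperFilter F.
  by apply: Build_ProperFilter => -[N _ FN]; apply: inf_t; exists N.
have cvF : cvg (w @ F).
  apply: cauchy_cvg; apply: cauchy_exP => eps eps0.
  have e2 : 0 < eps / 2 by rewrite divr_gt0.
  have [N _ eN] := cvgr_lt _ e0 _ e2.
  have [i iN /contrapT it] : exists2 i, (N <= i)%N & ~ lab i <> t.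
    apply: contrapT => h; apply: inf_t; exists N => j jN lt.
    by apply: h; exists j.
  exists (w i), N => // j /= jN jt; rewrite -ball_normE/=.
  rewrite (le_lt_trans (ler_normr_enorm _))// (le_lt_trans (we _ _ _)) ?it//.
  by have := eN _ iN; have := eN _ jN; rewrite /=; lra.
exists (lim (w @ F)) => eps eps0.
(* Adding 1 keeps the divisor positive when [k = 0]. *)
have k1 : 0 < Num.sqrt k%:R + 1 :> R by rewrite ltr_wpDl ?sqrtr_ge0.
have : \forall j \near \oo, lab j = t ->
    `|lim (w @ F) - w j| < eps / (Num.sqrt k%:R + 1).
  by move/cvgrPdist_lt: cvF; apply; rewrite divr_gt0.
apply: filterS => j h jt.
rewrite enorm_dist (le_lt_trans (ler_enorm_normr _))//.
have := h jt; rewrite ltr_pdivlMr//; apply: le_lt_trans.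
by rewrite mulrC ler_wpM2l ?normr_ge0// lerDl.
Qed.

(* A finite set of points contains only separated ones, so a sequence with
   vanishing steps that approaches the set must settle at one of them. *)
Lemma finite_label_cvg {R : realType} {k : nat} {T : finType} (lab : nat -> T)
    (w : nat -> 'cV[R]_k) (e : nat -> R) :
  e @ \oo --> (0 : R) ->
  (forall i j, lab i = lab j -> enorm (w i - w j) <= e i + e j) ->
  enorm (w j.+1 - w j) @[j --> \oo] --> (0 : R) ->
  exists l : 'cV[R]_k, w @ \oo --> l.
Proof.
move=> e0 we dw.
have /choice[l lP] : forall t, exists l, forall eps, 0 < eps ->
    \forall j \near \oo, lab j = t -> enorm (w j - l) < eps.
  by move=> t; exact: label_cvg _ _ _ _ e0 we.
have near_l eps : 0 < eps -> \forall j \near \oo, enorm (w j - l (lab j)) < eps.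
  move=> eps0; have : \forall j \near \oo, forall t, lab j = t ->
      enorm (w j - l t) < eps by apply: filter_forall => t; exact: lP.
  by apply: filterS => j; apply.
(* A common separation [d] of the distinct limits exists because there are finitely many pairs of
   labels. *)
have [d d0 dP] : exists2 d : R, 0 < d &
    forall s t, enorm (l s - l t) < d -> l s = l t.
  have sep : \forall d \near (0 : R)^'+,
      forall p : T * T, enorm (l p.1 - l p.2) < d -> l p.1 = l p.2.
    apply: filter_forall => -[s t] /=.
    have [->|] := eqVneq (l s) (l t); first exact: nearW.
    rewrite -subr_eq0 => st; have st0 : 0 < enorm (l s - l t).
      rewrite lt_neqAle enorm_ge0 andbT eq_sym.
      by apply: contra_neq st => /enorm_eq0.
    apply: filterS (nbhs_right_le st0) => d dst /lt_le_trans/(_ dst).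
    by rewrite ltxx.
  have [d [d0 dP]] := filter_ex (filterI (nbhs_right_gt 0) sep).
  by exists d => // s t /(dP (s, t)).
(* Two consecutive limits are joined through [w j.+1] and [w j] by three distances, hence thirds of
   [d]. *)
have d3 : 0 < d / 3 by rewrite divr_gt0.
have [N _ NP] : \forall j \near \oo,
    enorm (w j - l (lab j)) < d / 3 /\ enorm (w j.+1 - w j) < d / 3.
  by near=> j; split; near: j; [exact: near_l|exact: cvgr_lt _ dw _ d3].
have stable j : (N <= j)%N -> l (lab j) = l (lab N).
  elim: j => [|j IH]; first by rewrite leqn0 => /eqP->.
  rewrite leq_eqVlt ltnS => /orP[/eqP<-//|jN]; rewrite -(IH jN); apply: dP.
  have [h1 h2] := NP _ jN; have [h3 _] := NP _ (leqW jN).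
  have := ler_enorm_dist (l (lab j.+1)) (w j.+1) (l (lab j)).
  have := ler_enorm_dist (w j.+1) (w j) (l (lab j)).
  rewrite (enorm_dist _ (w j.+1)); lra.
exists (l (lab N)); apply/enorm_cvg/cvgr0Pnorm_lt => eps eps0; near=> j.
rewrite ger0_norm ?enorm_ge0// -(stable j); first by near: j; exact: near_l.
by near: j; exists N.
Unshelve. all: by end_near. Qed.

(** [F (w j)] is squeezed between the tangent lower bound at [z] and the upper bound of the descent
    lemma, both tending to [F z]. *)
Lemma lipschitz_monotone_cvg {R : realType} {k : nat} (F : 'cV[R]_k -> R)
    (c l : R) (w : nat -> 'cV[R]_k)
    (z : 'cV[R]_k) :
  (forall z d, is_derive z d F (dotv (grad F z) d)) ->
  lipschitz_gradient l F -> 0 < c ->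
  strongly_monotone_grad c F ->
  w @ \oo --> z -> F (w j) @[j --> \oo] --> F z.
Proof.
move=> dF lF c0 cF /enorm_cvg wz.
have aw a : a * enorm (w j - z) @[j --> \oo] --> (0 : R).
  by rewrite -(mulr0 a); exact: cvgMl_tmp.
apply: (@squeeze_cvgr _ _ _ _
  (fun j => F z - enorm (grad F z) * enorm (w j - z))
  (fun j => F z + enorm (grad F z) * enorm (w j - z)
            + l / 2 * (enorm (w j - z) * enorm (w j - z)))).
- apply: nearW => j; have := descent_lemma _ dF l z (w j - z) lF.
  have := strong_monotone_lower _ dF c z (w j - z) cF; rewrite subrKC.
  have := dotv_le (grad F z) (w j - z); have := dotv_le (- grad F z) (w j - z).
  rewrite enormN dotvNl -expr2.
  have : 0 <= c / 2 * enorm (w j - z) ^+ 2.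
    by rewrite mulr_ge0 ?sqr_ge0// divr_ge0 ?ltW.
  by move=> h1 h2 h3 h4 h5; apply/andP; split; lra.
- rewrite -[X in _ --> X]subr0; apply: cvgB; [exact: cvg_cst|exact: aw].
- rewrite -[X in _ --> X]addr0 -[X in _ --> X + _]addr0; apply: cvgD.
    by apply: cvgD; [exact: cvg_cst|exact: aw].
  by rewrite -(mulr0 (l / 2)) -(mulr0 0); apply: cvgMl_tmp; exact: cvgM.
Qed.

(** * Limits of norms, blocks, coordinates and positive-entry counts *)

Lemma enorm_continuous {R : realType} {k : nat} (w : nat -> 'cV[R]_k)
    (l : 'cV[R]_k) :
  w @ \oo --> l -> enorm (w j) @[j --> \oo] --> enorm l.
Proof.
move=> /enorm_cvg wl; apply/subr_cvg0/norm_cvg0P.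
apply: (squeeze_cvgr _ (cvg_cst 0) wl); apply: nearW => j.
rewrite normr_ge0 /= ler_norml.
have := ler_enormD (w j - l) l; rewrite subrK.
have := ler_enormD (l - w j) (w j); rewrite subrK (enorm_dist l).
by move=> h1 h2; apply/andP; split; lra.
Qed.

Lemma cvg_dsubmx {R : realType} {n m : nat} (w : nat -> 'cV[R]_(n + m))
    (l : 'cV[R]_(n + m)) :
  w @ \oo --> l -> dsubmx (w j) @[j --> \oo] --> dsubmx l.
Proof.
move=> /enorm_cvg wl; apply/enorm_cvg.
apply: (squeeze_cvgr _ (cvg_cst 0) wl); apply: nearW => j.
by rewrite enorm_ge0 -dsubmxB enorm_dsubmx.
Qed.

Lemma cvg_coord {R : realType} {k : nat} (w : nat -> 'cV[R]_k)
    (l : 'cV[R]_k) i :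
  w @ \oo --> l -> w j i 0 @[j --> \oo] --> l i 0.
Proof.
move=> /enorm_cvg wl; apply/subr_cvg0/norm_cvg0P.
apply: (squeeze_cvgr _ (cvg_cst 0) wl); apply: nearW => j.
by rewrite normr_ge0 /=; have := normr_le_enorm (w j - l) i; rewrite !mxE.
Qed.

(** Each positive coordinate of the limit is eventually positive along the sequence, and there are
    finitely many coordinates. *)
Lemma npos_lsc {R : realType} {k : nat} (w : nat -> 'cV[R]_k)
    (l : 'cV[R]_k) :
  w @ \oo --> l -> \forall j \near \oo, (npos l <= npos (w j))%N.
Proof.
move=> wl; have : \forall j \near \oo, forall i, 0 < l i 0 -> 0 < w j i 0.
  apply: filter_forall => i; have [l0|l0] := ltP 0 (l i 0); last exact: nearW.
  apply: filterS (cvgr_gt _ (cvg_coord _ _ i wl) _ l0) => j h _; exact: h.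
apply: filterS => j h; apply/subset_leq_card/fintype.subsetP => i; rewrite !inE.
exact: h.
Qed.

(** The count could drop in the limit only if positive entries shrank to 0; the gap [s] forbids
    this. *)
Lemma npos_gap {R : realType} {k : nat} (w : nat -> 'cV[R]_k)
    (l : 'cV[R]_k) (s : R) :
  0 < s -> (forall j i, 0 < w j i 0 -> s <= w j i 0) -> w @ \oo --> l ->
  \forall j \near \oo, npos (w j) = npos l.
Proof.
move=> s0 ws wl.
have : \forall j \near \oo, forall i, 0 < w j i 0 -> 0 < l i 0.
  apply: filter_forall => i; have [l0|l0] := ltP 0 (l i 0); first exact: nearW.
  apply: filterS (cvgr_lt _ (cvg_coord _ _ i wl) s (le_lt_trans l0 s0)) => j /=.
  by rewrite ltNge => /negP h /ws.
move: (npos_lsc _ _ wl); apply: filterS2 => j h1 h2.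
apply/eqP; rewrite eqn_leq h1 andbT.
by apply/subset_leq_card/fintype.subsetP => i; rewrite !inE; exact: h2.
Qed.

(** * Hard thresholding as a proximal map *)

(** For [s > 0], keeping [s] costs [c], whereas the best nonpositive choice is 0 and costs
    [s ^+ 2 / 2]; they balance at [Num.sqrt (2 * c)]. A negative [s] is kept at no cost. *)
Lemma prox_npos_coord {R : realType} (c s z : R) : 0 < c ->
  let z0 := if 0 <= s < Num.sqrt (2 * c) then 0 else s in
  c * (0 < z0)%R%:R + 2^-1 * (z0 - s) ^+ 2
  <= c * (0 < z)%R%:R + 2^-1 * (z - s) ^+ 2.
Proof.
move=> c0 /=.
have sq : Num.sqrt (2 * c) ^+ 2 = 2 * c by rewrite sqr_sqrtr// mulr_ge0 ?ltW.
have q0 : 0 < Num.sqrt (2 * c) by rewrite sqrtr_gt0 mulr_gt0.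
have zs : 0 <= 2^-1 * (z - s) ^+ 2 by rewrite mulr_ge0 ?sqr_ge0.
case: ifPn => [/andP[s0 sc]|].
  rewrite ltxx mulr0 add0r sub0r sqrrN; case: (ltP 0 z) => z0.
    have : s ^+ 2 <= 2 * c by rewrite -sq ler_sqr ?nnegrE ?(ltW sc) ?(ltW q0).
    by rewrite mulr1; lra.
  by rewrite mulr0 add0r; nra.
rewrite subrr expr0n mulr0 addr0 negb_and -ltNge -leNgt.
case: (ltP 0 s) => [s0|_ _]; last first.
  by rewrite mulr0 addr_ge0// mulr_ge0 ?ler0n ?(ltW c0).
rewrite mulr1 ltNge (ltW s0) /= => qs; case: (ltP 0 z) => z0.
  by rewrite mulr1 lerDl.
have : 2 * c <= s ^+ 2 by rewrite -sq ler_sqr ?nnegrE ?(ltW s0) ?(ltW q0).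
by rewrite mulr0 add0r; nra.
Qed.

Lemma prox_npos_threshold {R : realType} {k : nat} (c : R) (v : 'cV[R]_k) :
  0 < c ->
  prox_npos c v
    (\col_i if 0 <= v i 0 < Num.sqrt (2 * c) then 0 else v i 0).
Proof.
move=> c0 z; rewrite !sqr_enorm !npos_sum !mulr_sumr -!big_split/=.
by apply: ler_sum => i _; rewrite !mxE -!expr2; exact: prox_npos_coord.
Qed.

(** * The half step: descent, near-stationarity and gap *)

Lemma dotv_col0d {R : realType} {n m : nat} (z : 'cV[R]_(n + m)) w :
  dotv z (col_mx 0 w) = dotv (dsubmx z) w.
Proof. by rewrite dotv_col_mx col_mxKu col_mxKd dotv0r add0r. Qed.

Lemma dotv_colu0 {R : realType} {n m : nat} (z : 'cV[R]_(n + m)) w :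
  dotv z (col_mx w 0) = dotv (usubmx z) w.
Proof. by rewrite dotv_col_mx col_mxKu col_mxKd dotv0r addr0. Qed.

Section HalfStep.
Context {R : realType} {m n : nat}.
Variables (f : 'cV[R]_n -> R) (lambda rho mu : R).
Variables (A : 'M[R]_(m, n)) (b p : 'cV[R]_m) (q : 'cV[R]_n).
Variables (ell alpha t : R).

Local Notation g := (gfun f rho mu A b p q).
Local Notation G := (Gfun f lambda rho mu A b p q).
Local Notation gx := (grad_x f rho mu A b p q).
Local Notation gu := (grad_u f rho mu A b p q).
Local Notation fwd := (forward_u f rho mu A b p q alpha).
Local Notation Gam := (Gamma f lambda rho mu A b p q alpha).
Local Notation half := (half_step f lambda rho mu A b p q alpha t).

Hypotheses (lambda0 : 0 < lambda) (alpha0 : 0 < alpha) (t0 : 0 < t).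
Hypothesis df : forall x, differentiable f x.
Hypothesis lg : lipschitz_gradient ell g.
Implicit Types z d : 'cV[R]_(n + m).

(** The point between the two block updates: [u] has moved, [x] has not. Each of the moves [z] to
    [mid z] to [half z] changes one block only. *)
Let mid z := col_mx (usubmx z) (dsubmx (half z)).

Let al0 : 0 < alpha * lambda. Proof. exact: mulr_gt0. Qed.

Lemma half_step_prox z :
  prox_npos (alpha * lambda) (fwd z) (dsubmx (half z)).
Proof.
rewrite /half_step col_mxKd.
have := prox_npos_threshold (alpha * lambda) (fwd z) al0.
congr prox_npos; apply/matrixP => i j; rewrite ord1 mxE [RHS]mxE.
by rewrite inE mulrA.
Qed.

Let half_x z : usubmx (half z - z) = - (t *: gx (mid z)).
Proof.
by rewrite usubmxB /mid /half_step col_mxKu col_mxKd addrAC subrr add0r.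
Qed.

Let half_u z i : i \notin Gam z ->
  dsubmx (half z - z) i 0 = - (alpha * gu z i 0).
Proof.
move=> iG; rewrite dsubmxB /half_step col_mxKd 2!mxE (negPf iG) /forward_u.
by rewrite !mxE addrAC subrr add0r mulrN.
Qed.

Let midB z : mid z - z = col_mx 0 (dsubmx (half z - z)).
Proof.
rewrite -[LHS]vsubmxK usubmxB [usubmx (mid z)]col_mxKu subrr.
by rewrite dsubmxB [dsubmx (mid z)]col_mxKd -dsubmxB.
Qed.

Let halfB z : half z - mid z = col_mx (usubmx (half z - z)) 0.
Proof.
rewrite -[LHS]vsubmxK dsubmxB [dsubmx (mid z)]col_mxKd subrr.
by rewrite usubmxB [usubmx (mid z)]col_mxKu -usubmxB.
Qed.

(** The descent lemma is applied to each block move. The prox inequality absorbs the [u] gradient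
    term and gains [1 / (2 * alpha)]; the gradient step in [x] gains [1 / t]. *)
Lemma half_step_descent z :
  Num.min (1 / (2 * alpha) - ell / 2) (1 / t - ell / 2)
    * enorm (half z - z) ^+ 2 <= G z - G (half z).
Proof.
set tau := Num.min _ _.
have tau1 : tau <= 1 / (2 * alpha) - ell / 2 by rewrite ge_min lexx.
have tau2 : tau <= 1 / t - ell / 2 by rewrite ge_min lexx orbT.
have D1 := descent_lemma g (is_derive_gfun _ _ _ _ _ _ _ df) ell z
  (mid z - z) lg.
have D2 := descent_lemma g (is_derive_gfun _ _ _ _ _ _ _ df) ell (mid z)
  (half z - mid z) lg.
(* Optimality of the new [u] is tested against the old one. *)
have P := half_step_prox z (dsubmx z).
move: D1; rewrite subrKC midB sqr_enorm !dotv_col0d.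
rewrite [dsubmx (col_mx 0 _)]col_mxKd -/(gu z) => D1.
move: D2; rewrite subrKC halfB sqr_enorm !dotv_colu0.
rewrite [usubmx (col_mx _ 0)]col_mxKu -/(gx (mid z)).
rewrite sqr_enorm (dotv_col_mx (half z - z)).
move: D1 P; rewrite !sqr_enorm.
set dx := usubmx (half z - z); set du := dsubmx (half z - z).
have -> : dotv (gx (mid z)) dx = - (1 / t * dotv dx dx).
  rewrite {2}/dx half_x dotvNl dotvZl mulrN opprK mulrA div1r mulVf ?mul1r//.
  exact: lt0r_neq0.
have -> : dsubmx (half z) - fwd z = du + alpha *: gu z.
  by rewrite /du dsubmxB /forward_u scalerN opprD opprK addrA.
have -> : dsubmx z - fwd z = alpha *: gu z.
  by rewrite /forward_u scalerN opprD opprK addrA subrr add0r.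
rewrite /Gfun; set h := (npos (dsubmx z))%:R; set h' := (npos _)%:R.
rewrite !(dotvDl, dotvDr, dotvZl, dotvZr) (dotvC du (gu z)).
set X := dotv dx dx; set U := dotv du du; set W := dotv (gu z) du => D1 P D2.
(* The prox inequality divided by [alpha]; the squared norm of [alpha *: gu z] occurs on both sides
   and cancels. *)
have {}P : lambda * h' + 1 / (2 * alpha) * U + W <= lambda * h.
  rewrite -(ler_pM2l alpha0).
  have -> : alpha * (lambda * h' + 1 / (2 * alpha) * U + W)
    = alpha * lambda * h' + 2^-1 * U + alpha * W.
    by field; exact: lt0r_neq0.
  by rewrite mulrA; lra.
have X0 : 0 <= X by exact: dotvv_ge0.
have U0 : 0 <= U by exact: dotvv_ge0.
have := ler_wpM2r X0 tau2; have := ler_wpM2r U0 tau1.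
move: D1 D2 P; clear tau1 tau2.
move: tau (1 / (2 * alpha)) (1 / t) => tau ia it; lra.
Qed.

(** The updates give [gx (mid z)] as [- t^-1] times the [x] displacement and, off [Gam z], [gu z] as
    [- alpha^-1] times the [u] displacement. Moving each gradient to [half z] costs at most [ell]
    times the displacement, whence [2 * ell]. *)
Lemma half_step_stationary z d :
  0 <= ell -> (forall i, i \in Gam z -> dsubmx d i 0 = 0) ->
  dotv (grad g (half z)) d
  <= (t^-1 + alpha^-1 + 2 * ell) * enorm (half z - z) * enorm d.
Proof.
move=> ell0 dG; set e := enorm (half z - z).
have e0 : 0 <= e := enorm_ge0 _; have d0 := enorm_ge0 d.
have hmid : enorm (half z - mid z) <= e.
  rewrite halfB -ler_sqr ?nnegrE ?enorm_ge0// !sqr_enorm !dotv_col_mx.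
  rewrite col_mxKu col_mxKd lerD2l.
  by rewrite dotv0r dotvv_ge0.
have bound k (v w : 'cV[R]_k) a c : 0 <= c -> enorm v <= c -> enorm w <= a ->
    dotv v w <= c * a.
  move=> c0 vc wa; apply: le_trans (dotv_le v w) _.
  by apply: ler_pM => //; exact: enorm_ge0.
have dxd := enorm_usubmx d; have dud := enorm_dsubmx d.
have B1 : dotv (gx (half z)) (usubmx d)
    <= ell * e * enorm d + dotv (gx (mid z)) (usubmx d).
  rewrite -lerBlDr -dotvBl; apply: bound => //; first exact: mulr_ge0.
  rewrite -usubmxB (le_trans (enorm_usubmx _))// (le_trans (lg _ _))//.
  exact: ler_wpM2l.
have B2 : dotv (gu (half z)) (dsubmx d)
    <= ell * e * enorm d + dotv (gu z) (dsubmx d).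
  rewrite -lerBlDr -dotvBl; apply: bound => //; first exact: mulr_ge0.
  by rewrite -dsubmxB (le_trans (enorm_dsubmx _))// (le_trans (lg _ _)).
have B3 : dotv (gx (mid z)) (usubmx d) <= t^-1 * e * enorm d.
  have -> : gx (mid z) = - t^-1 *: usubmx (half z - z).
    by rewrite half_x scalerN scaleNr opprK scalerA mulVf ?scale1r ?lt0r_neq0.
  apply: bound => //; first by rewrite mulr_ge0// invr_ge0 ltW.
  rewrite enormZ normrN gtr0_norm ?invr_gt0// ler_wpM2l ?enorm_usubmx//.
  by rewrite invr_ge0 ltW.
have B4 : dotv (gu z) (dsubmx d) <= alpha^-1 * e * enorm d.
  have -> : dotv (gu z) (dsubmx d)
      = dotv (- alpha^-1 *: dsubmx (half z - z)) (dsubmx d).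
    apply: eq_bigr => i _; have [iG|iG] := boolP (i \in Gam z).
      by rewrite dG// !mulr0.
    by rewrite [in RHS]mxE half_u// mulrNN mulrA mulVf ?mul1r ?lt0r_neq0.
  apply: bound => //; first by rewrite mulr_ge0// invr_ge0 ltW.
  rewrite enormZ normrN gtr0_norm ?invr_gt0// ler_wpM2l ?enorm_dsubmx//.
  by rewrite invr_ge0 ltW.
rewrite dotv_col_mx.
apply: le_trans (lerD (le_trans B1 (lerD (lexx _) B3))
                      (le_trans B2 (lerD (lexx _) B4))) _.
by rewrite le_eqVlt; apply/predU1P; left; ring.
Qed.

(** A positive entry has survived the thresholding, so it reaches the threshold; this provides the
    gap for [npos_gap]. *)
Lemma half_step_gap z i :
  0 < dsubmx (half z) i 0 ->
  Num.sqrt (2 * alpha * lambda) <= dsubmx (half z) i 0.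
Proof.
rewrite /half_step col_mxKd mxE inE; case: ifPn; rewrite ?ltxx// => + h.
by rewrite (ltW h) /= -leNgt.
Qed.

Lemma half_step_Gamma z i : i \in Gam z -> dsubmx (half z) i 0 = 0.
Proof. by move=> iG; rewrite /half_step col_mxKd mxE iG. Qed.

(** Both half steps vanish on the common index set, so their difference is an admissible direction
    in [half_step_stationary] at either point; strong monotonicity converts the two bounds into a
    distance. *)
Lemma half_step_label (c : R) z z' : 0 <= ell -> 0 < c ->
  strongly_monotone_grad c g ->
  Gam z = Gam z' ->
  enorm (half z - half z')
  <= (t^-1 + alpha^-1 + 2 * ell) / c * enorm (half z - z)
     + (t^-1 + alpha^-1 + 2 * ell) / c * enorm (half z' - z').
Proof.
move=> ell0 c0 cg eqG.
have K0 : 0 <= t^-1 + alpha^-1 + 2 * ell.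
  by rewrite !addr_ge0 ?invr_ge0 ?(ltW alpha0) ?(ltW t0) ?mulr_ge0.
rewrite -mulrDr mulrAC mulrDr.
have dG (w w' : 'cV[R]_(n + m)) i :
    dsubmx w i 0 = 0 -> dsubmx w' i 0 = 0 -> dsubmx (w - w') i 0 = 0.
  by rewrite !mxE => -> ->; rewrite subrr.
apply: (strong_monotone_dist _ _ _ _ _ _ c0 cg).
- by rewrite mulr_ge0 ?enorm_ge0.
- by rewrite mulr_ge0 ?enorm_ge0.
- apply: (half_step_stationary z (half z - half z') ell0) => i iG.
  have iG' : i \in Gam z' by rewrite -eqG.
  exact: dG (half_step_Gamma z i iG) (half_step_Gamma z' i iG').
- apply: (half_step_stationary z' (half z' - half z) ell0) => i iG'.
  have iG : i \in Gam z by rewrite eqG.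
  exact: dG (half_step_Gamma z' i iG') (half_step_Gamma z i iG).
Qed.

End HalfStep.

(** * Vanishing displacements and passage to the limit *)

Lemma cvg0_of_sqr_le {R : realType} (c : R) (a D : nat -> R) :
  0 < c -> (forall j, 0 <= a j) -> (forall j, c * a j ^+ 2 <= D j) ->
  D @ \oo --> (0 : R) -> a @ \oo --> (0 : R).
Proof.
move=> c0 a0 aD D0.
have sD : Num.sqrt (D j / c) @[j --> \oo] --> (0 : R).
  rewrite -[X in _ --> X](@sqrtr0 R) -[X in _ --> Num.sqrt X](mul0r c^-1).
  by apply: continuous_cvg; [exact: sqrt_continuous|exact: cvgMr_tmp].
apply: (squeeze_cvgr _ (cvg_cst 0) sD); apply: nearW => j; rewrite a0 /=.
rewrite -[leLHS]ger0_norm// -sqrtr_sqr ler_wsqrtr// ler_pdivlMr// mulrC.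
exact: aD.
Qed.

Lemma nonincreasing_diff_cvg0 {R : realType} (u : nat -> R) M :
  nonincreasing_seq u -> (forall j, M <= u j) ->
  u j - u j.+1 @[j --> \oo] --> (0 : R).
Proof.
move=> du Mu; have cu : u @ \oo --> inf (range u).
  by apply: nonincreasing_cvgn => //; exists M => _ [j _ <-].
rewrite -(subrr (inf (range u))); apply: cvgB => //.
by move: cu; rewrite -cvg_shiftS.
Qed.

(** Both conditions are inherited from the half steps: vanishing displacement forces the [x]
    gradient to 0, and prox optimality passes to the limit because the count of positive entries has
    stabilised. *)
Lemma limit_P_stationary {R : realType} {m n : nat} (f : 'cV[R]_n -> R)
    (lambda rho mu : R) (A : 'M[R]_(m, n)) b p q (ell alpha t : R)
    (z : nat -> 'cV[R]_(n + m)) (l : 'cV[R]_(n + m)) :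
  let half := half_step f lambda rho mu A b p q alpha t in
  0 < lambda -> 0 < alpha -> 0 < t -> 0 <= ell ->
  (forall x, differentiable f x) ->
  lipschitz_gradient ell (gfun f rho mu A b p q) ->
  z @ \oo --> l ->
  half (z j) @[j --> \oo] --> l ->
  (\forall j \near \oo, npos (dsubmx (half (z j))) = npos (dsubmx l)) ->
  P_stationary f lambda rho mu A b p q alpha l (- grad_u f rho mu A b p q l).
Proof.
move=> half lambda0 alpha0 t0 ell0 df lg zl hl hn.
have hz0 : enorm (half (z j) - z j) @[j --> \oo] --> (0 : R).
  rewrite -(@enorm0 R (n + m)) -(subrr l).
  by apply: enorm_continuous; exact: cvgB.
have hl0 : enorm (l - half (z j)) @[j --> \oo] --> (0 : R).
  rewrite -(@enorm0 R (n + m)) -(subrr l).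
  by apply: enorm_continuous; apply: cvgB => //; exact: cvg_cst.
set K := t^-1 + alpha^-1 + 2 * ell.
split=> //.
  (* The direction has zero [u] block, so it is admissible for every index set; the
     near-stationarity bound then gives |gx|^2 <= 0 in the limit. *)
  set gx := grad_x _ _ _ _ _ _ _ l; pose d := col_mx gx (0 : 'cV[R]_m).
  have Kd0 : ell * enorm (l - half (z j)) * enorm d
      + K * enorm (half (z j) - z j) * enorm d @[j --> \oo] --> (0 : R).
    rewrite -[X in _ --> X]addr0 -[X in _ --> X + _](mul0r (enorm d)).
    rewrite -[X in _ --> _ + X](mul0r (enorm d)).
    apply: cvgD; apply: cvgMr_tmp.
      by rewrite -(mulr0 ell); exact: cvgMl_tmp.
    by rewrite -(mulr0 K); exact: cvgMl_tmp.
  have gxd : dotv gx gx <= 0.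
    apply: (cvgr_to_ge Kd0); apply: nearW => j.
    have S := half_step_stationary f lambda rho mu A b p q ell alpha t
      alpha0 t0 lg (z j) d ell0.
    have dG i : i \in Gamma f lambda rho mu A b p q alpha (z j) ->
        dsubmx d i 0 = 0 by rewrite col_mxKd mxE.
    have {dG}S := S dG.
    have L : dotv (grad (gfun f rho mu A b p q) l
                   - grad (gfun f rho mu A b p q) (half (z j))) d
        <= ell * enorm (l - half (z j)) * enorm d.
      by rewrite (le_trans (dotv_le _ _))// ler_wpM2r ?enorm_ge0.
    have -> : dotv gx gx = dotv (grad (gfun f rho mu A b p q) l) d.
      by rewrite dotv_colu0.
    move: L; rewrite dotvBl lerBlDr => /le_trans; apply.
    by rewrite lerD2l.
  apply: enorm_eq0; apply/eqP; rewrite -sqrf_eq0 sqr_enorm eq_le gxd.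
  exact: dotvv_ge0.
have gl : grad_u f rho mu A b p q (z j) @[j --> \oo]
    --> grad_u f rho mu A b p q l.
  apply: cvg_dsubmx; apply/enorm_cvg.
  have lz0 : ell * enorm (z j - l) @[j --> \oo] --> (0 : R).
    by rewrite -(mulr0 ell); apply: cvgMl_tmp; exact/enorm_cvg.
  apply: (squeeze_cvgr _ (cvg_cst 0) lz0); apply: nearW => j.
  by rewrite enorm_ge0 lg.
have vl : forward_u f rho mu A b p q alpha (z j) @[j --> \oo]
    --> forward_u f rho mu A b p q alpha l.
  exact: cvgD (cvg_dsubmx _ _ zl) (cvgZl_tmp (cvgN gl)).
have sq (a : nat -> R) (a' c : R) : a @ \oo --> a' ->
    c + 2^-1 * a j ^+ 2 @[j --> \oo] --> c + 2^-1 * a' ^+ 2.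
  move=> aa'; apply: cvgD; first exact: cvg_cst.
  by apply: cvgMl_tmp; exact: (cvgM aa' aa').
have enorm2 (w : nat -> 'cV[R]_m) (v : 'cV[R]_m) c : w @ \oo --> v ->
    c + 2^-1 * enorm (w j - forward_u f rho mu A b p q alpha (z j)) ^+ 2
      @[j --> \oo]
    --> c + 2^-1 * enorm (v - forward_u f rho mu A b p q alpha l) ^+ 2.
  by move=> wv; exact: sq (enorm_continuous _ _ (cvgB wv vl)).
(* For a fixed competitor [v] both sides of the prox inequality converge. *)
move=> v; apply: (ler_cvg_to (enorm2 _ _ _ (cvg_dsubmx _ _ hl))
  (enorm2 (fun=> v) v _ (cvg_cst v))).
apply: filterS hn => j <-; exact: half_step_prox.
Qed.

(** * Descent, convergence and P-stationarity for GSNewton *)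

Theorem theorem7 (R : realType) (m n : nat)
    (f : 'cV[R]_n -> R) (lambda rho mu : R)
    (A : 'M[R]_(m, n)) (b p : 'cV[R]_m) (q : 'cV[R]_n)
    (sigma_f ell_f ell_g alpha t : R)
    (zeta zeta_half zeta_newton : nat -> 'cV[R]_(n + m)) :
  let g := gfun f rho mu A b p q in
  let G := Gfun f lambda rho mu A b p q in
  let sigma_g := mu - sigma_f in
  let y := fun j => - grad_u f rho mu A b p q (zeta j) in
  let tau := Num.min (1 / (2 * alpha) - ell_g / 2) (1 / t - ell_g / 2) in
  0 < lambda -> 0 < rho -> 0 < mu ->
  twice_continuously_differentiable f ->
  weakly_convex sigma_f f ->
  lipschitz_gradient ell_f f ->
  sigma_f < mu ->
  lipschitz_gradient ell_g g ->
  0 < alpha < 1 / ell_g ->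
  0 < t < 2 / ell_g ->
  GSNewton f lambda rho mu A b p q sigma_g alpha t
    zeta zeta_half zeta_newton ->
  [/\ nonincreasing_seq (G \o zeta),
      0 < tau,
      forall j, tau * enorm (zeta_half j - zeta j) ^+ 2
                  + sigma_g / 4 * enorm (zeta j.+1 - zeta_half j) ^+ 2
                <= G (zeta j) - G (zeta j.+1),
      enorm (zeta_half j - zeta j) @[j --> \oo] --> (0 : R)
    & enorm (zeta j.+1 - zeta j) @[j --> \oo] --> (0 : R)] /\
  exists (zeta_hat : 'cV[R]_(n + m)) (y_hat : 'cV[R]_m),
    [/\ P_stationary f lambda rho mu A b p q alpha zeta_hat y_hat,
        zeta @ \oo --> zeta_hat
      & y @ \oo --> y_hat] /\
    [/\ (npos (dsubmx (zeta j.+1)))%:R @[j --> \oo]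
          --> ((npos (dsubmx zeta_hat))%:R : R),
        (npos (dsubmx (zeta_half j)))%:R @[j --> \oo]
          --> ((npos (dsubmx zeta_hat))%:R : R)
      & G (zeta j) @[j --> \oo] --> G zeta_hat].
Proof.
move=> g G sigma_g y tau lam0 rho0 mu0 [df _ _] wf _ smu lg.
move=> /andP[al0 al1] /andP[t0 t1] alg.
(* Positivity of [ell_g] is read off from the nonempty range of [alpha]. *)
have ell0 : 0 < ell_g by rewrite -invr_gt0 -div1r (lt_trans al0).
have tau0 : 0 < tau.
  have a1 : alpha * ell_g < 1 by rewrite -ltr_pdivlMr.
  have t2 : t * ell_g < 2 by rewrite -ltr_pdivlMr.
  by rewrite lt_min !subr_gt0 !ltr_pdivlMr ?mulr_gt0//; apply/andP; split; lra.
have sg0 : 0 < sigma_g / 4 by rewrite divr_gt0// subr_gt0.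
have dg := is_derive_gfun f rho mu A b p q df.
have [c c0 cg] := gfun_strong_monotone f sigma_f rho mu A b p q rho0 df wf smu.
have [M gM] := strong_monotone_bounded_below _ dg _ c0 cg.
have halfE j : zeta_half j
    = half_step f lambda rho mu A b p q alpha t (zeta j) by case: (alg j).
have half_desc j : tau * enorm (zeta_half j - zeta j) ^+ 2
    <= G (zeta j) - G (zeta_half j).
  by rewrite halfE; exact: half_step_descent.
have newton_desc j : sigma_g / 4 * enorm (zeta j.+1 - zeta_half j) ^+ 2
    <= G (zeta_half j) - G (zeta j.+1).
  (* Acceptance is this very inequality; after a rejection both sides are 0. *)
  case: (alg j) => _ _ ->; case: ifPn => // _.
  by rewrite !subrr enorm0 expr0n mulr0.
have half_ge0 j : 0 <= tau * enorm (zeta_half j - zeta j) ^+ 2.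
  by rewrite mulr_ge0 ?sqr_ge0 ?(ltW tau0).
have newton_ge0 j : 0 <= sigma_g / 4 * enorm (zeta j.+1 - zeta_half j) ^+ 2.
  by rewrite mulr_ge0 ?sqr_ge0 ?(ltW sg0).
have desc j : tau * enorm (zeta_half j - zeta j) ^+ 2
    + sigma_g / 4 * enorm (zeta j.+1 - zeta_half j) ^+ 2
    <= G (zeta j) - G (zeta j.+1).
  by have := lerD (half_desc j) (newton_desc j); rewrite addrA subrK.
have G_dec : nonincreasing_seq (G \o zeta).
  apply/nonincreasing_seqP => j /=; rewrite -subr_ge0.
  by apply: le_trans (desc j); exact: addr_ge0.
have GM j : M <= (G \o zeta) j.
  apply: le_trans (gM (zeta j)) _; rewrite lerDl mulr_ge0 ?ler0n//.
  exact: ltW.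
have dG0 := nonincreasing_diff_cvg0 _ _ G_dec GM.
have half0 : enorm (zeta_half j - zeta j) @[j --> \oo] --> (0 : R).
  apply: (cvg0_of_sqr_le tau _ _ tau0 _ _ dG0) => j; first exact: enorm_ge0.
  by apply: le_trans (desc j); rewrite lerDl.
have newton0 : enorm (zeta j.+1 - zeta_half j) @[j --> \oo] --> (0 : R).
  apply: (cvg0_of_sqr_le _ _ _ sg0 _ _ dG0) => j; first exact: enorm_ge0.
  by apply: le_trans (desc j); rewrite lerDr.
have sum0 (u v : nat -> R) : u @ \oo --> (0 : R) -> v @ \oo --> (0 : R) ->
    u j + v j @[j --> \oo] --> (0 : R).
  by move=> u0 v0; rewrite -(addr0 0); exact: cvgD.
have step0 : enorm (zeta j.+1 - zeta j) @[j --> \oo] --> (0 : R).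
  apply: (squeeze_cvgr _ (cvg_cst 0) (sum0 _ _ newton0 half0)).
  by apply: nearW => j; rewrite enorm_ge0 ler_enorm_dist.
split=> //.
have [l hl] : exists l : 'cV[R]_(n + m), zeta_half @ \oo --> l.
  pose K := (t^-1 + alpha^-1 + 2 * ell_g) / c.
  (* The labels are the index sets [Gamma], of which there are finitely many. *)
  apply: (finite_label_cvg
    (fun j => Gamma f lambda rho mu A b p q alpha (zeta j)) _
    (fun j => K * enorm (zeta_half j - zeta j))).
  - by rewrite -(mulr0 K); exact: cvgMl_tmp.
  - move=> i j eqG; rewrite !halfE.
    exact: half_step_label (ltW ell0) c0 cg eqG.
  (* Consecutive half steps are joined through [zeta j.+1]: the next half-step displacement plus the
     current Newton displacement. *)
  - have half0S : enorm (zeta_half j.+1 - zeta j.+1) @[j --> \oo] --> (0 : R).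
      by move: half0; rewrite -cvg_shiftS.
    apply: (squeeze_cvgr _ (cvg_cst 0) (sum0 _ _ half0S newton0)).
    by apply: nearW => j; rewrite enorm_ge0 ler_enorm_dist.
have zl : zeta @ \oo --> l.
  apply/enorm_cvg; move/enorm_cvg: hl => hl.
  apply: (squeeze_cvgr _ (cvg_cst 0) (sum0 _ _ half0 hl)).
  apply: nearW => j.
  by rewrite enorm_ge0 (enorm_dist (zeta_half j)) ler_enorm_dist.
have zSl : zeta j.+1 @[j --> \oo] --> l by move: zl; rewrite -cvg_shiftS.
have hn : \forall j \near \oo, npos (dsubmx (zeta_half j)) = npos (dsubmx l).
  apply: (npos_gap _ _ (Num.sqrt (2 * alpha * lambda))).
  - by rewrite sqrtr_gt0 !mulr_gt0.
  - by move=> j i; rewrite halfE; exact: half_step_gap.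
  - exact: cvg_dsubmx.
have gcv w : w @ \oo --> l -> g (w j) @[j --> \oo] --> g l.
  exact: (lipschitz_monotone_cvg _ _ _ _ _ dg lg c0 cg).
(* An accepted Newton point cannot raise lambda * npos while g barely moves. *)
have nS : \forall j \near \oo, npos (dsubmx (zeta j.+1)) = npos (dsubmx l).
  have gd0 : g (zeta_half j) - g (zeta j.+1) @[j --> \oo] --> (0 : R).
    by rewrite -(subrr (g l)); apply: cvgB; exact: gcv.
  near=> j; apply/eqP; rewrite eqn_leq; apply/andP; split; last first.
    by near: j; exact: npos_lsc (cvg_dsubmx _ _ zSl).
  have hj : npos (dsubmx (zeta_half j)) = npos (dsubmx l) by near: j.
  have gj : g (zeta_half j) - g (zeta j.+1) < lambda.
    by near: j; exact: cvgr_lt _ gd0 _ lam0.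
  have := le_trans (newton_ge0 j) (newton_desc j).
  rewrite /G /Gfun -/g hj subr_ge0 => Gj.
  (* Counts are integers, so it suffices to exclude an excess of one entry, whose price is
     [lambda]. *)
  rewrite -ltnS -(@ltr_nat R) -(ltr_pM2l lam0) -natr1 mulrDr mulr1; lra.
have npos_cvg (w : nat -> 'cV[R]_(n + m)) :
    (\forall j \near \oo, npos (dsubmx (w j)) = npos (dsubmx l)) ->
    (npos (dsubmx (w j)))%:R @[j --> \oo] --> ((npos (dsubmx l))%:R : R).
  by move=> wn; apply: cvg_near_cst; apply: filterS wn => j ->.
(* The count was compared at [zeta j.+1], the successor of a half step, so the limit is taken along
   the shifted sequence first. *)
have Gl : G (zeta j.+1) @[j --> \oo] --> G l.
  by apply: cvgD; [exact: gcv|apply: cvgMl_tmp; exact: npos_cvg].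
exists l, (- grad_u f rho mu A b p q l); split; split=> //.
- apply: (limit_P_stationary _ _ _ _ _ _ _ _ ell_g alpha t zeta) => //.
  + exact: ltW.
  + by move: hl; rewrite [zeta_half](funext halfE).
  + by apply: filterS hn => j; rewrite -halfE.
- apply: cvgN; apply: cvg_dsubmx; apply/enorm_cvg.
  have lz0 : ell_g * enorm (zeta j - l) @[j --> \oo] --> (0 : R).
    by rewrite -(mulr0 ell_g); apply: cvgMl_tmp; exact/enorm_cvg.
  apply: (squeeze_cvgr _ (cvg_cst 0) lz0); apply: nearW => j.
  by rewrite enorm_ge0 lg.
- exact: npos_cvg.
- exact: npos_cvg.
- by rewrite -cvg_shiftS; exact: Gl.
Unshelve. all: by end_near. Qed.
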